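(* Let $N\ge 1$, $\mathcal I=\{1,\dots,N\}$, and consider the system $$\dot x_i=\sum_{j\in\mathcal I}s(x_j-x_i)(x_j-x_i),\qquad i\in\mathcal I,\qquad (\ast)$$ where $s:\mathbb R\to\mathbb R$ is given by $s(\tau)=1$ if $|\tau|<1$ and $s(\tau)=0$ if $|\tau|\ge 1$. Then the following hold. (i) (Existence) For every initial condition $\bar x\in\mathbb R^N$ there exists a local Krasovskii solution $x(\cdot)$ to $(\ast)$ with $x(0)=\bar x$. Moreover, let $x(\cdot)$ be a Krasovskii solution to $(\ast)$. On its domain of definition: (ii) (Order preservation) For all $i,j\in\mathcal I$, if $x_i(t_1)<x_j(t_1)$, then $x_i(t_2)<x_j(t_2)$ for every $t_2>t_1$. (iii) (Contractivity) For all $t_2>t_1$, $\overline{\mathrm{co}}(\{x_i(t_2)\}_{i\in\mathcal I})\subset\overline{\mathrm{co}}(\{x_i(t_1)\}_{i\in\mathcal I})$. (iv) (Completeness) The solution $x(\cdot)$ is complete, i.e. it can be extended to a Krasovskii solution defined for all $t>0$. (v) (Average preservation) Let $x_{\mathrm{ave}}(t)=N^{-1}\sum_{i=1}^N x_i(t)$. Then $x_{\mathrm{ave}}(t)=x_{\mathrm{ave}}(0)$ for all $t>0$.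
   Context: $\overline{\mathrm{co}}(A)$ denotes the closed convex hull of a set $A$. For $g:\mathbb R^N\to\mathbb R^N$ (possibly discontinuous), a Krasovskii solution of $\dot x=g(x)$, $x(0)=\bar x$, on an interval $I\subset[0,+\infty)$ containing $0$ is an absolutely continuous map $\phi:I\to\mathbb R^N$ with $\phi(0)=\bar x$ and $\dot\phi(t)\in\mathcal K g(\phi(t))$ for almost every $t\in I$, where $$\mathcal K g(x)=\bigcap_{\delta>0}\overline{\mathrm{co}}\left(\{g(y):\|x-y\|<\delta\}\right).$$ A local solution is one defined on some interval $[0,\varepsilon)$ with $\varepsilon>0$. The times $t_1,t_2,t$ in the statement belong to the domain of definition of the solution. *)

(* Defs.v *)
From HB Require Import structures.
From mathcomp Require Import all_boot all_order all_algebra.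
From mathcomp Require Import all_classical all_reals all_analysis.

Set Implicit Arguments.
Unset Strict Implicit.
Unset Printing Implicit Defensive.

Import Order.TTheory GRing.Theory Num.Theory.
Import numFieldNormedType.Exports.

Local Open Scope classical_set_scope.
Local Open Scope ring_scope.

Definition closed_convex_hull (R : realType) (V : normedModType R)
    (A : set V) : set V :=
  smallest [set C : set V | closed C /\ convex_set C] A.

(* R^N is 'rV[R]_N. Its library norm is the max norm; as all norms on R^N are
   equivalent and the radius d ranges over all positive reals, the intersection
   does not depend on the choice of norm. *)
Definition krasovskii (R : realType) (N : nat) (g : 'rV[R]_N -> 'rV[R]_N)
    (x : 'rV[R]_N) : set 'rV[R]_N :=
  \bigcap_(d in [set d : R | 0 < d])
    closed_convex_hull (g @` [set y | `|x - y| < d]).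

Definition abs_continuous (R : realType) (V : normedModType R)
    (J : set R) (f : R -> V) : Prop :=
  forall e : R, 0 < e -> exists2 d : R, 0 < d &
    forall (n : nat) (a b : 'I_n -> R),
      (forall i, [/\ J (a i), J (b i) & a i <= b i]) ->
      trivIset [set: 'I_n] (fun i => `]a i, b i[%classic) ->
      \sum_(i < n) (b i - a i) < d ->
      \sum_(i < n) `|f (b i) - f (a i)| < e.

(* Absolute continuity of a Caratheodory-type solution on an arbitrary interval
   is required on each compact subinterval. *)
Definition loc_abs_continuous (R : realType) (V : normedModType R)
    (I : set R) (f : R -> V) : Prop :=
  forall a b : R, I a -> I b -> abs_continuous `[a, b] f.

(* A map defined on I is encoded as a total function whose values outside I are
   irrelevant: is_derive at t only depends on the values near t, and the at most
   two endpoints of I form a null set. *)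
Definition krasovskii_solution (R : realType) (N : nat)
    (g : 'rV[R]_N -> 'rV[R]_N) (xbar : 'rV[R]_N) (I : set R)
    (x : R -> 'rV[R]_N) : Prop :=
  [/\ is_interval I, I `<=` `[0, +oo[, I 0 & x 0 = xbar] /\
  loc_abs_continuous I x /\
  {ae lebesgue_measure, forall t : R, I t ->
    exists2 v : 'rV[R]_N, krasovskii g (x t) v & is_derive t 1 x v}.

Definition s (R : realType) (tau : R) : R := if `|tau| < 1 then 1 else 0.

Definition bounded_confidence (R : realType) (N : nat) (x : 'rV[R]_N) :
    'rV[R]_N :=
  \row_(i < N) \sum_(j < N) s (x 0 j - x 0 i) * (x 0 j - x 0 i).

Definition x_ave (R : realType) (N : nat) (x : R -> 'rV[R]_N) (t : R) : R :=
  N%:R^-1 * \sum_(i < N) x t 0 i.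

(* Main.v *)
Require Import Defs.
From HB Require Import structures.
From mathcomp Require Import all_boot all_order all_algebra.
From mathcomp Require Import all_classical all_reals all_analysis.
From mathcomp Require Import measurable_realfun ring lra.

Set Implicit Arguments.
Unset Strict Implicit.
Unset Printing Implicit Defensive.

Import Order.TTheory GRing.Theory Num.Theory.
Import numFieldNormedType.Exports.

Local Open Scope classical_set_scope.
Local Open Scope ring_scope.

(** Write g for the right-hand side.  Since every term s(u) u has absolute value
    at most 1, g is bounded by N, and this alone gives existence and
    completeness; the other claims are one-sided estimates on linear
    functionals of the velocity.

    Estimates.  Let l be a linear functional.  A half-space c - e <= l(v) is
    closed and convex, so if it contains the values of g near x, for every
    e > 0, then c <= l(v) for every v in the Krasovskii set at x
    ([krasovskii_dot_ge]).  Integrating along a solution needs only that an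
    absolutely continuous function with derivative at least c almost everywhere
    grows at least at rate c ([abs_continuous_derive_ge]); the combination is
    [krasovskii_solution_dot_ge].  With l(v) = v_i it gives Lipschitz
    continuity, and with l(v) = sum_i v_i, for which l o g = 0 by antisymmetry,
    the conservation of the average.

    Order.  In spite of its jumps, s(u) u satisfies a one-sided bound:
    s(u - D)(u - D) - s(u) u >= - D for every D >= 0.  Hence the gap
    D = x_j - x_i satisfies D' >= - N D as long as D > 0, and a positive gap
    cannot vanish in finite time ([solution_order]).  Contractivity follows: an
    agent that is rightmost at time t2 was rightmost at all earlier times, by
    order preservation, and a rightmost agent has nonpositive velocity
    ([solution_max_le]); symmetrically on the left.

    Existence.  Euler approximations of step 1 / (n + 1), kept constant between
    two grid points, stay in a compact set at each time, so they converge
    pointwise along any nonprincipal ultrafilter on the indices.  The limit x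
    is Lipschitz.  Its difference quotient over [t, t + q]
    is a limit of averages of values of g at points close to x(t), so that
    wherever x is differentiable its derivative lies in the Krasovskii set
    ([euler_limit_krasovskii]).  A Lipschitz function is differentiable almost
    everywhere ([lipschitz_ae_derivable]): up to a linear term it is
    nondecreasing, its Lebesgue-Stieltjes measure is dominated by the Lebesgue
    measure, and it is the indefinite integral of its Radon-Nikodym derivative.

    Completeness.  The Euler construction gives a solution on the whole half
    line [T, +oo[ from any point.  Given a solution on a bounded interval I, its
    Lipschitz extension provides the value at T = sup I from which to continue
    ([krasovskii_solution_complete]). *)

(** * Almost everywhere differentiability of Lipschitz functions *)

Lemma lipschitz_continuous (R : realType) (V : normedModType R) (C : R)
    (f : R -> V) :
  (forall r t, `|f r - f t| <= C * `|r - t|) -> continuous f.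
Proof.
move=> fC t; apply/(@cvgrPdist_le _ V) => e e0.
have C0 : 0 <= C.
  by have := fC 1 0; rewrite subr0 normr1 mulr1; exact: le_trans.
have C1 : 0 < C + 1 by rewrite ltr_wpDl.
near=> r; apply: le_trans (fC _ _) _.
apply: (@le_trans _ _ ((C + 1) * `|t - r|)).
  by rewrite ler_wpM2r// lerDl.
rewrite mulrC -ler_pdivlMr//; near: r.
by apply: (@cvgr_dist_le _ R R _ _ id); [exact: cvg_id|exact: divr_gt0].
Unshelve. all: by end_near. Qed.

(** A cover of a Lebesgue-null set by intervals of total length less than eps
    has Stieltjes mass less than C eps, so the domination can be read off the
    outer measures. *)
Lemma stieltjes_lipschitz_dominates (R : realType) (C : R) (F : cumulative R R) :
  (forall a b, a <= b -> F b - F a <= C * (b - a)) ->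
  lebesgue_stieltjes_measure F `<< @lebesgue_measure R.
Proof.
move=> FC; apply/null_content_dominatesP => A mA A0.
have C0 : 0 <= C.
  have := FC 0 1 ler01; rewrite subr0 mulr1; apply: le_trans.
  by rewrite subr_ge0 cumulative_is_nondecreasing.
apply/eqP; rewrite eq_le measure_ge0 andbT.
apply/lee_addgt0Pr => e e0; rewrite add0e.
have C1 : 0 < C + 1 by rewrite ltr_wpDl.
have /ereal_inf_lt[_ [B [mB AB] <-] Be] :
    (lebesgue_measure A < (e / (C + 1))%:E)%E.
  by rewrite A0 lte_fin divr_gt0.
apply: (@le_trans _ _ (\sum_(0 <= k <oo) wlength F (B k))%E).
  by apply: ereal_inf_lbound; exists B.
apply: (@le_trans _ _ (\sum_(0 <= k <oo) (C%:E * wlength idfun (B k)))%E).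
  apply: lee_nneseries => k _; first by move=> _; exact: wlength_ge0.
  have /ocitvP[->|[[a b]/= ab ->]] := mB k; first by rewrite !wlength0 mule0.
  rewrite !(wlength_itv_bnd _ _ _ (ltW ab)).
  by rewrite -EFinM lee_fin FC// ltW.
rewrite nneseriesZl; last by move=> k _; exact: (wlength_ge0 (idfun : cumulative R R)).
apply: (@le_trans _ _ (C%:E * (e / (C + 1))%:E)%E).
  by rewrite lee_wpmul2l ?lee_fin// ltW.
by rewrite -EFinM lee_fin mulrCA ger_pMr// ler_pdivrMr// mul1r lerDl ler01.
Qed.

(** On a bounded interval the function is the indefinite integral of the
    Radon-Nikodym derivative of its Stieltjes measure, to which the Lebesgue
    form of the fundamental theorem of calculus applies. *)
Lemma nondecreasing_lipschitz_ae_derivable (R : realType) (C : R)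
    (G : R -> R) : {homo G : a b / a <= b} ->
  (forall a b, a <= b -> G b - G a <= C * (b - a)) ->
  {ae @lebesgue_measure R, forall t, derivable G t 1}.
Proof.
move=> ndG GC.
have cG : continuous G.
  apply: (@lipschitz_continuous _ R C) => a b.
  wlog ab : a b / a <= b => [H|].
    have [/H//|/ltW/H] := leP a b; by rewrite distrC [X in _ -> _ <= C * X]distrC.
  rewrite distrC [X in C * X]distrC !ger0_norm ?subr_ge0//; [exact: GC|exact: ndG].
have [F FG] : exists F : cumulative R R, forall t, F t = G t.
  pose F : cumulative R R := HB.pack G
    (isCumulative.Build R _ R G ndG (right_continuousW cG)).
  by exists F.
have FC a b : a <= b -> F b - F a <= C * (b - a) by rewrite !FG; exact: GC.
(* Radon-Nikodym requires a finite measure, hence the restriction to ]-n, n]. *)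
suff H (n : nat) : {ae @lebesgue_measure R, forall t : R,
    - n%:R < t -> t < n%:R -> derivable G t 1}.
  have := ae_foralln H; apply: filterS => t Ht.
  have tn : `|t| < (Num.bound `|t|)%:R by exact: archi_boundP.
  by apply: (Ht (Num.bound `|t|)); move: tn; rewrite ltr_norml => /andP[].
pose D := `]- n%:R, n%:R : R]%classic.
have nn : - n%:R <= n%:R :> R by rewrite -subr_ge0 opprK -natrD.
have FE (a b : R) : a <= b ->
    lebesgue_stieltjes_measure F `]a, b] = (F b - F a)%:E.
  move=> ab; rewrite /lebesgue_stieltjes_measure /measure_extension/=.
  by rewrite measurable_mu_extE//= ?wlength_itv_bnd//; exact: is_ocitv.
pose muF : {measure set (measurableTypeR R) -> \bar R} :=
  lebesgue_stieltjes_measure F.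
have mD : @measurable _ (measurableTypeR R) D by exact: measurable_itv.
have DF : (muF D < +oo)%E by rewrite /muF/= FE// ltry.
pose nu : {finite_measure set (measurableTypeR R) -> \bar R} := mfrestr mD DF.
have numu : nu `<< @lebesgue_measure R.
  apply/null_content_dominatesP => A mA A0.
  have /null_content_dominatesP := stieltjes_lipschitz_dominates FC.
  apply; first exact: measurableI.
  apply/eqP; rewrite eq_le measure_ge0 andbT -[leRHS]A0.
  by apply: le_measure; rewrite ?inE//; exact: measurableI.
have [g [g0 gfin ig nuE]] := radon_nikodym_sigma_finite numu.
pose h : R -> R := fine \o g.
have hg : EFin \o h = g by apply/funext => t; rewrite /= fineK.
have FI t : - n%:R <= t -> t <= n%:R ->
    G t = G (- n%:R) + (\int[lebesgue_measure]_(y in `]- n%:R, t]) h y)%R.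
  move=> nt tn; rewrite /Rintegral -!FG.
  under eq_integral do rewrite -[(h _)%:E]/((EFin \o h) _) hg.
  rewrite -nuE; last exact: measurable_itv.
  rewrite [nu _](_ : _ = (F t - F (- n%:R))%:E) /=; first by rewrite /= addrC subrK.
  rewrite -FE// /nu/= /mfrestr /mrestr; congr (lebesgue_stieltjes_measure F _).
  apply/setIidPl => y; rewrite /D/= !in_itv/= => /andP[-> /le_trans]; exact.
have ih : lebesgue_measure.-integrable setT (EFin \o h) by rewrite hg.
have lh : locally_integrable setT h.
  by apply: open_integrable_locally => //; exact: openT.
have ihy y : lebesgue_measure.-integrable `]- n%:R, y] (EFin \o h).
  by apply: integrableS ih => //; exact: measurable_itv.
have := @FTC1 R h (BRight (- n%:R)) ihy lh.
apply: filterS; first exact: (ae_filter_ringOfSetsType lebesgue_measure).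
move=> t dF nt tn.
have [|dt _] := dF; first exact: nt.
apply: (@near_eq_derivable R R R (fun x => G (- n%:R) +
  (\int[lebesgue_measure]_(y in `]- n%:R, x]) h y)%R)); last first.
  by apply: derivableD => //; exact: dt.
near=> u; apply/esym/FI; apply: ltW; near: u.
- exact: lt_nbhsr.
- exact: lt_nbhsl.
Unshelve. all: by end_near. Qed.

(** Adding C t to the function makes it nondecreasing. *)
Lemma lipschitz_ae_derivable (R : realType) (C : R) (f : R -> R) :
  (forall r t, `|f r - f t| <= C * `|r - t|) ->
  {ae @lebesgue_measure R, forall t, derivable f t 1}.
Proof.
move=> fC; pose G t := f t + C * t.
have H a b : a <= b -> - (C * (b - a)) <= f b - f a <= C * (b - a).
  move=> ab; have := fC b a.
  by rewrite (ger0_norm (_ : 0 <= b - a)) ?subr_ge0// ler_norml.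
have : {ae @lebesgue_measure R, forall t, derivable G t 1}.
  apply: (@nondecreasing_lipschitz_ae_derivable _ (C + C)) => a b ab;
    rewrite /G; have /andP[] := H _ _ ab; lra.
apply: filterS; first exact: (ae_filter_ringOfSetsType lebesgue_measure).
move=> t dG.
have -> : f = G - ( *%R C).
  by apply/funext => r; rewrite /G !fctE addrK.
by apply: derivableB => //.
Qed.

(** * Monotonicity of absolutely continuous functions *)

Lemma is_derive_near (R : realType) (V : normedModType R) (f : R -> V) (t : R)
    (v : V) (e : R) : is_derive t 1 f v -> 0 < e ->
  exists2 d, 0 < d &
    forall r, `|r - t| < d -> `|f r - f t - (r - t) *: v| <= e * `|r - t|.
Proof.
move=> [dft dfv] e0.
have : h^-1 *: (f (h *: 1 + t) - f t) @[h --> 0^'] --> v by rewrite -dfv.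
move=> /(@cvgrPdist_le _ V)/(_ e e0) [d /= d0 dH].
exists d => // r rt; have [->|rt0] := eqVneq r t.
  by rewrite !subrr scale0r subrr !normr0 mulr0.
have rt1 : r - t != 0 by rewrite subr_eq0.
have := dH (r - t); rewrite /= sub0r normrN => /(_ rt rt1).
rewrite -[(r - t) *: 1]/((r - t) * 1) mulr1 subrK => h.
rewrite -[X in `|X - _|](scalerKV rt1) -scalerBr normrZ mulrC.
by rewrite ler_wpM2r// distrC.
Qed.

(** This is Cousin's lemma.  Let t be the supremum of the r such that Q a r: a
    local pair ending at t gives Q a t, and a local pair starting at t excludes
    t < b. *)
Lemma segment_induction (R : realType) (Q : R -> R -> Prop) (a b : R) :
  a <= b ->
  (forall x y z, x <= y -> y <= z -> Q x y -> Q y z -> Q x z) ->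
  (forall t, a <= t -> t <= b -> exists2 d, 0 < d &
    forall r r', a <= r -> r <= t -> t <= r' -> r' <= b ->
      t - d < r -> r' < t + d -> Q r r') ->
  Q a b.
Proof.
move=> ab Qtrans Qloc.
pose S : set R := [set t | [/\ a <= t, t <= b & Q a t]].
have Sa : S a.
  split=> //; have [d d0 H] := Qloc a (lexx _) ab.
  by apply: H => //; rewrite ?ltrDl// ltrBlDr ltrDl.
have supS : has_sup S by split; [exists a|exists b => t []].
have at_ : a <= sup S by apply: ub_le_sup => //; case: supS.
have tb : sup S <= b by apply: ge_sup => [|t []//]; exists a.
have [d d0 H] := Qloc _ at_ tb.
have [r [ar rb Qar] dr] := sup_adherent d0 supS.
have rt : r <= sup S by apply: ub_le_sup => //; case: supS.
have Qat : Q a (sup S).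
  by apply: Qtrans Qar _ => //; apply: H; rewrite // ltrDl.
have [tltb|blet] := ltP (sup S) b; last first.
  by have <- : sup S = b by apply/eqP; rewrite eq_le tb blet.
pose r' := Num.min b (sup S + d / 2).
have tr' : sup S < r' by rewrite lt_min tltb ltrDl divr_gt0.
suff : S r'.
  by move=> /(ub_le_sup (proj2 supS)); rewrite leNgt tr'.
have r'b : r' <= b by rewrite ge_min lexx.
split=> //; first exact: le_trans at_ (ltW tr').
apply: (Qtrans _ (sup S)) => //; first exact: ltW.
apply: H => //; [exact: ltW|by rewrite ltrBlDr ltrDl|].
by rewrite gt_min ltrD2l ltr_pdivrMr// ltr_pMr// ltr1n orbT.
Qed.

Lemma pairwise_itv_trivIset (R : realType) (l : seq (R * R)) :
  pairwise (fun p q => p.2 <= q.1) l ->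
  trivIset [set: 'I_(size l)]
    (fun i => `](nth (0, 0) l i).1, (nth (0, 0) l i).2[%classic).
Proof.
move=> /(pairwiseP (0, 0)) lpw i j _ _ [x []]; rewrite /= !in_itv/=.
move=> /andP[ix xi] /andP[jx xj]; apply/val_inj => /=.
have [ij|ji|//] := ltngtP (i : nat) (j : nat).
- have := lpw i j (ltn_ord i) (ltn_ord j) ij.
  by move=> /(lt_le_trans xi)/lt_trans/(_ jx); rewrite ltxx.
- have := lpw j i (ltn_ord j) (ltn_ord i) ji.
  by move=> /(lt_le_trans xj)/lt_trans/(_ ix); rewrite ltxx.
Qed.

Lemma sum_itv_le_measure (R : realType) (U : set R) (l : seq (R * R)) :
  open U -> pairwise (fun p q => p.2 <= q.1) l ->
  (forall p, p \in l -> p.1 <= p.2 /\ `]p.1, p.2[%classic `<=` U) ->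
  ((\sum_(p <- l) (p.2 - p.1))%:E <= @lebesgue_measure R U)%E.
Proof.
move=> oU lpw lU; pose F (i : 'I_(size l)) : set R :=
  `](nth (0, 0) l i).1, (nth (0, 0) l i).2[%classic.
have mF (i : 'I_(size l)) : measurable (F i) by exact: measurable_itv.
have -> : (\sum_(p <- l) (p.2 - p.1))%:E =
    @lebesgue_measure R (\big[setU/set0]_(i < size l) F i).
  rewrite measure_bigsetU_ord//; last exact: pairwise_itv_trivIset.
  rewrite (big_nth (0, 0)) big_mkord -sumEFin; apply: eq_bigr => i _.
  have [lei _] := lU _ (mem_nth (0, 0) (ltn_ord i)).
  rewrite [RHS](lebesgue_measure_itv `](nth (0, 0) l i).1, (nth (0, 0) l i).2[).
  rewrite /= lte_fin lt_neqAle lei andbT.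
  by case: eqP => //= ->; rewrite subrr.
apply: le_measure; rewrite ?inE.
- by apply: bigsetU_measurable => i _; exact: mF.
- exact: open_measurable.
- apply: (big_ind (fun S : set R => S `<=` U)); first exact: sub0set.
    by move=> S T SU TU x [/SU|/TU].
  by move=> i _; have [] := lU _ (mem_nth (0, 0) (ltn_ord i)).
Qed.

(** The exceptional points are covered by an open set U of small measure.  Near
    a point outside U the increments of f are controlled by its derivative;
    an interval included in U is instead recorded in a list, and absolute
    continuity bounds the total variation of f over the recorded intervals
    because their total length is at most the measure of U. *)
Lemma abs_continuous_derive_ge (R : realType) (f : R -> R) (c a b : R) :
  a <= b -> abs_continuous `[a, b] f ->
  {ae @lebesgue_measure R, forall t, a < t -> t < b ->
    exists2 v, c <= v & is_derive t 1 f v} ->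
  c * (b - a) <= f b - f a.
Proof.
move=> ab acf aef.
suff H e : 0 < e -> c * (b - a) <= f b - f a + (b - a + 2) * e.
  apply/ler_addgt0Pr => e e0.
  have ba2 : 0 < b - a + 2 by rewrite ltr_wpDl// subr_ge0.
  by have := H _ (divr_gt0 e0 ba2); rewrite mulrCA divff ?gt_eqF// mulr1.
move=> e0.
have [d d0 acd] := acf e e0.
have c1 : 0 < `|c| + 1 by rewrite ltr_wpDl.
(* The second bound absorbs the term c (r' - r) on the recorded intervals. *)
pose d' := Num.min d (e / (`|c| + 1)).
have d'0 : 0 < d' by rewrite lt_min d0 divr_gt0.
have [U [oU EU mU]] : exists U : set R, [/\ open U,
    forall t, a <= t -> t <= b -> ~ U t ->
      exists2 v, c <= v & is_derive t 1 f v &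
    (@lebesgue_measure R U < d'%:E)%E].
  have [A [mA A0 aA]] := aef.
  have mab : measurable ([set a] `|` [set b]).
    by apply: measurableU; exact: measurable_set1.
  have ab0 : @lebesgue_measure R ([set a] `|` [set b]) = 0%E.
    apply: null_set_setU; [exact: measurable_set1|exact: measurable_set1| |];
      exact: lebesgue_measure_set1.
  (* The endpoints join the null set: no derivative is known there. *)
  pose D : set R := A `|` ([set a] `|` [set b]).
  have mD : measurable D by exact: measurableU.
  have D0 : @lebesgue_measure R D = 0%E by exact: null_set_setU.
  have Doo : (@lebesgue_measure R D < +oo)%E by rewrite D0 ltry.
  have [U [oU DU mU]] := lebesgue_regularity_outer mD Doo d'0.
  exists U; split => //.
    move=> t at_ tb nUt; apply: contrapT => nt; apply/nUt/DU.
    have [->|ta] := eqVneq t a; first by right; left.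
    have [->|tb'] := eqVneq t b; first by right; right.
    left; apply: aA => /= H; apply: nt; apply: H.
      by rewrite lt_neqAle eq_sym ta.
    by rewrite lt_neqAle tb'.
  apply: le_lt_trans mU.
  have mU := open_measurable oU.
  rewrite [leLHS](_ : _ = lebesgue_measure (U `\` D `|` U `&` D)); last first.
    by rewrite setUC setUIDK.
  rewrite measureU0//; [exact: measurableD|exact: measurableI|].
  apply/eqP; rewrite eq_le measure_ge0 andbT -[leRHS]D0.
  by apply: le_measure; rewrite ?inE//; exact: measurableI.
pose Q (r r' : R) := exists l : seq (R * R),
  [/\ forall p, p \in l ->
        [/\ r <= p.1, p.1 <= p.2, p.2 <= r' & `]p.1, p.2[%classic `<=` U],
      pairwise (fun p q => p.2 <= q.1) l &
      (c - e) * (r' - r) <=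
      f r' - f r + \sum_(p <- l) (`|f p.2 - f p.1| + `|c| * (p.2 - p.1))].
suff [l [lP lpw lle]] : Q a b.
  have lU : \sum_(p <- l) (p.2 - p.1) < d'.
    rewrite -lte_fin; apply: le_lt_trans mU; apply: sum_itv_le_measure => //.
    by move=> p /lP[].
  have lf : \sum_(p <- l) `|f p.2 - f p.1| < e.
    rewrite (big_nth (0, 0)) big_mkord.
    apply: (acd _ (fun i => (nth (0, 0) l i).1) (fun i => (nth (0, 0) l i).2)).
    - move=> i; have [ai ii ib _] := lP _ (mem_nth (0, 0) (ltn_ord i)).
      by split => //=; rewrite in_itv/=; apply/andP; split => //;
        [exact: le_trans ib|exact: le_trans ii].
    - exact: pairwise_itv_trivIset.
    - rewrite -(big_mkord xpredT (fun i => (nth (0, 0) l i).2 - (nth (0, 0) l i).1)).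
      rewrite -(big_nth (0, 0) xpredT (fun p => p.2 - p.1)).
      by apply: lt_le_trans lU _; rewrite ge_min lexx.
  have lc : `|c| * \sum_(p <- l) (p.2 - p.1) <= e.
    have : \sum_(p <- l) (p.2 - p.1) <= e / (`|c| + 1).
      by apply: le_trans (ltW lU) _; rewrite ge_min lexx orbT.
    rewrite ler_pdivlMr// mulrC; apply: le_trans.
    rewrite ler_wpM2r ?lerDl//.
    by rewrite big_seq sumr_ge0// => p /lP[_ ? _ _]; rewrite subr_ge0.
  move: lle; rewrite big_split/= -mulr_sumr; lra.
apply: segment_induction => //.
  move=> x y z xy yz [l [lP lpw lle]] [l' [l'P l'pw l'le]].
  exists (l ++ l'); split.
  - move=> p; rewrite mem_cat => /orP[/lP|/l'P] [? ? ? ?]; split => //.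
    + exact: le_trans yz.
    + exact: le_trans xy _.
  - rewrite pairwise_cat lpw l'pw !andbT.
    apply/allrelP => p q /lP[_ _ py _] /l'P[yq _ _ _]; exact: le_trans yq.
  - rewrite big_cat/=; lra.
move=> t at_ tb.
have [Ut|nUt] := pselect (U t).
  have [η /= η0 ηU] : exists2 η, 0 < η & forall r, `|t - r| < η -> U r.
    have : nbhs t U by exact: open_nbhs_nbhs.
    by move=> [η /= η0 H]; exists η.
  exists η => // r r' ar rt tr' r'b tr r't.
  exists [:: (r, r')]; split=> //.
  - move=> p; rewrite inE => /eqP ->; split => //=; first exact: le_trans tr'.
    move=> y /=; rewrite in_itv/= => /andP[ry yr']; apply: ηU.
    by rewrite ltr_norml; apply/andP; split; lra.
  - rewrite big_seq1/=.
    have : - `|f r' - f r| <= f r' - f r by rewrite lerNl -normrN ler_norm.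
    have : (c - e) * (r' - r) <= `|c| * (r' - r).
      rewrite ler_wpM2r// ?subr_ge0 ?(le_trans rt)//.
      by rewrite (le_trans _ (ler_norm _))// gerBl ltW.
    lra.
have [v cv dv] := EU t at_ tb nUt.
have [η η0 ηH] := is_derive_near dv e0.
exists η => // r r' ar rt tr' r'b tr r't.
exists [::]; split => //; rewrite big_nil addr0.
have := ηH r; have := ηH r'.
rewrite (@ger0_norm _ (r' - t)) ?subr_ge0// (@ler0_norm _ (r - t)) ?subr_le0//.
have scE (x : R) : x *: v = x * v by [].
rewrite !scE !ler_norml => /(_ _)/andP[|+ _]; first lra.
move=> h1 /(_ _)/andP[|_ h2]; first lra.
have : 0 <= (r' - t) * (v - c) by rewrite mulr_ge0// subr_ge0.
have : 0 <= (t - r) * (v - c) by rewrite mulr_ge0// subr_ge0.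
lra.
Qed.

(** * Linear functionals of Krasovskii velocities *)

Lemma normr_coord_le (R : realType) (N : nat) (u : 'rV[R]_N) (i : 'I_N) :
  `|u 0 i| <= `|u|.
Proof.
rewrite [leRHS]mx_normrE.
exact: (@le_bigmax _ _ _ 0 (fun p : 'I_1 * 'I_N => `|u p.1 p.2|) (0, i)).
Qed.

Lemma norm_rV_le (R : realType) (N : nat) (u : 'rV[R]_N) (e : R) :
  0 <= e -> (forall i, `|u 0 i| <= e) -> `|u| <= e.
Proof.
move=> e0 ue; rewrite [`|u|]mx_normrE bigmax_le//.
by move=> [i j] _ /=; rewrite (ord1 i).
Qed.

(** All estimates on velocities reduce to lower bounds on such a functional; an
    upper bound is one for the opposite coefficients. *)
Definition dot (R : realType) (N : nat) (w : 'I_N -> R) (u : 'rV[R]_N) : R :=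
  \sum_(k < N) w k * u 0 k.

Section dot.
Context (R : realType) (N : nat).
Implicit Types (w : 'I_N -> R) (u v : 'rV[R]_N).

Lemma dotD w u v : dot w (u + v) = dot w u + dot w v.
Proof.
by rewrite /dot -big_split; apply: eq_bigr => k _; rewrite !mxE mulrDr.
Qed.

Lemma dotB w u v : dot w (u - v) = dot w u - dot w v.
Proof.
by rewrite /dot -sumrB; apply: eq_bigr => k _; rewrite !mxE mulrBr.
Qed.

Lemma dotZ w (c : R) u : dot w (c *: u) = c * dot w u.
Proof. by rewrite /dot mulr_sumr; apply: eq_bigr => k _; rewrite !mxE mulrCA. Qed.

Lemma dot_continuous w : continuous (dot w).
Proof.
rewrite /dot; apply: (@continuous_big R _ _ _ xpredT (@add_continuous R) 'rV[R]_N
  _ (fun k (u : 'rV[R]_N) => w k * u 0 k)) => k _ u.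
exact: (continuous_comp (@coord_continuous _ _ _ _ _ u) (@mulrl_continuous _ (w k) _)).
Qed.

Lemma normr_dot_le w u : `|dot w u| <= (\sum_k `|w k|) * `|u|.
Proof.
rewrite mulr_suml; apply: le_trans (ler_norm_sum _ _ _) _.
by apply: ler_sum => k _; rewrite normrM ler_wpM2l// normr_coord_le.
Qed.

Lemma closed_dot_ge w c : closed [set u | c <= dot w u].
Proof.
rewrite -[X in closed X]/(dot w @^-1` [set r | c <= r]).
by apply: closed_comp => [u _|]; [exact: dot_continuous|exact: closed_ge].
Qed.

Lemma convex_dot_ge w c : @convex_set R 'rV[R]_N [set u | c <= dot w u].
Proof.
move=> u v l; rewrite !inE/= => cu cv.
rewrite [X in dot w X](_ : _ =
  l%:num *: (u : 'rV[R]_N) + (1 - l%:num) *: (v : 'rV[R]_N))//.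
rewrite dotD !dotZ.
have l0 : 0 <= l%:num by [].
have l1 : 0 <= 1 - l%:num by rewrite subr_ge0.
have := ler_wpM2l l0 cu; have := ler_wpM2l l1 cv; lra.
Qed.

Lemma is_derive_dot w (x : R -> 'rV[R]_N) (t : R) v :
  is_derive t 1 x v -> is_derive t 1 (dot w \o x) (dot w v).
Proof.
move=> [dx xv].
have : h^-1 *: (x (h *: 1 + t) - x t) @[h --> 0^'] --> v by rewrite -xv.
move=> /(continuous_cvg _ (@dot_continuous w v)) H.
have {}H : h^-1 *: ((dot w \o x) (h *: 1 + t) - (dot w \o x) t) @[h --> 0^']
    --> dot w v.
  apply: cvg_trans H; apply: near_eq_cvg; near=> h.
  by rewrite /= dotZ dotB.
apply: DeriveDef; first by apply/cvg_ex; exists (dot w v).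
by apply/cvg_lim => //; exact: Rhausdorff.
Unshelve. all: by end_near. Qed.

End dot.

Lemma abs_continuous_dominated (R : realType) (V W : normedModType R)
    (J : set R) (f : R -> V) (h : R -> W) (K : R) :
  (forall r t, J r -> J t -> `|h r - h t| <= K * `|f r - f t|) ->
  abs_continuous J f -> abs_continuous J h.
Proof.
move=> hf acf e e0.
have K1 : 0 < `|K| + 1 by rewrite ltr_wpDl.
have [d d0 dH] := acf _ (divr_gt0 e0 K1).
exists d => // n a b abJ tab abd.
have := dH n a b abJ tab abd; rewrite ltr_pdivlMr//; apply: le_lt_trans.
rewrite mulr_suml; apply: ler_sum => i _; have [Ja Jb _] := abJ i.
apply: le_trans (hf _ _ Jb Ja) _; rewrite mulrC ler_wpM2l//.
by rewrite (le_trans (ler_norm _))// lerDl.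
Qed.

Lemma lipschitz_abs_continuous (R : realType) (V : normedModType R)
    (J : set R) (f : R -> V) (C : R) :
  (forall r t, J r -> J t -> `|f r - f t| <= C * `|r - t|) -> abs_continuous J f.
Proof.
move=> fC; apply: (@abs_continuous_dominated _ R _ _ id _ C) => // e e0.
exists e => // n a b abJ _; congr (_ < _); apply: eq_bigr => i _.
by have [_ _ ?] := abJ i; rewrite ger0_norm ?subr_ge0.
Qed.

(** A closed half-space is closed and convex: it contains the hull of a set as
    soon as it contains the set. *)
Lemma krasovskii_dot_ge (R : realType) (N : nat) (g : 'rV[R]_N -> 'rV[R]_N)
    (w : 'I_N -> R) (c : R) (x v : 'rV[R]_N) :
  (forall e, 0 < e -> exists2 d, 0 < d &
     forall y, `|x - y| < d -> c - e <= dot w (g y)) ->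
  krasovskii g x v -> c <= dot w v.
Proof.
move=> H Kv; apply/ler_addgt0Pr => e e0; rewrite -lerBlDr.
have [d d0 dH] := H e e0.
have := Kv d d0; move: v {Kv}; apply: (@smallest_sub _ _ _ [set u | c - e <= dot w u]).
  exact: (conj (@closed_dot_ge _ _ w (c - e)) (@convex_dot_ge _ _ w (c - e))).
by move=> _ [y xy <-]; exact: dH.
Qed.

(** An error linear in the distance to [z], for points close to [z], is enough:
    this spares each application the choice of a radius. *)
Lemma krasovskii_dot_ge_linear (R : realType) (N : nat)
    (g : 'rV[R]_N -> 'rV[R]_N) (w : 'I_N -> R) (c K d0 : R) (z v : 'rV[R]_N) :
  0 <= K -> 0 < d0 ->
  (forall (d : R) (y : 'rV[R]_N), 0 < d -> d <= d0 ->
    (forall k, `|z 0 k - y 0 k| <= d) -> c - K * d <= dot w (g y)) ->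
  krasovskii g z v -> c <= dot w v.
Proof.
move=> K0 d00 H; apply: krasovskii_dot_ge => e e0.
have K1 : 0 < K + 1 by rewrite ltr_wpDl.
pose d := Num.min d0 (e / (K + 1)).
have dd0 : d <= d0 by rewrite ge_min lexx.
have de : d * (K + 1) <= e by rewrite -ler_pdivlMr// ge_min lexx orbT.
have d1 : 0 < d by rewrite lt_min d00 divr_gt0.
exists d => // y zy; have zyk k : `|z 0 k - y 0 k| <= d.
  by apply: le_trans (ltW zy); apply: le_trans (normr_coord_le _ k); rewrite !mxE.
by apply: le_trans (H d y d1 dd0 zyk); lra.
Qed.

Lemma krasovskii_solution_dot_ge (R : realType) (N : nat)
    (g : 'rV[R]_N -> 'rV[R]_N) (xbar : 'rV[R]_N) (I : set R)
    (x : R -> 'rV[R]_N) (w : 'I_N -> R) (c t1 t2 : R) :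
  krasovskii_solution g xbar I x -> I t1 -> I t2 -> t1 <= t2 ->
  (forall t v, t1 < t -> t < t2 -> krasovskii g (x t) v -> c <= dot w v) ->
  c * (t2 - t1) <= dot w (x t2) - dot w (x t1).
Proof.
move=> [[itvI _ _ _] [acx aex]] It1 It2 t12 xc.
apply: (@abs_continuous_derive_ge _ (dot w \o x)) => //.
  apply: (@abs_continuous_dominated _ _ _ _ x _ (\sum_k `|w k|)) (acx _ _ It1 It2).
  by move=> r t _ _ /=; rewrite -dotB normr_dot_le.
move: aex; apply: filterS; first exact: (ae_filter_ringOfSetsType lebesgue_measure).
move=> t xt t1t tt2; have [|v Kv dv] := xt.
  by apply: (itvI _ _ It1 It2); rewrite !ltW.
exists (dot w v); last exact: is_derive_dot.
exact: xc Kv.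
Qed.

(** * Extension of Lipschitz maps *)

(** McShane's extension: the infimum of the upward cones of slope |C| with
    vertices on the graph of f. *)
Lemma lipschitz_extension (R : realType) (I : set R) (f : R -> R) (C : R) :
  I !=set0 ->
  (forall r t, I r -> I t -> `|f r - f t| <= C * `|r - t|) ->
  exists2 F : R -> R, (forall r t, `|F r - F t| <= `|C| * `|r - t|) &
    forall t, I t -> F t = f t.
Proof.
move=> [r0 Ir0] fC0.
have fC r t : I r -> I t -> f r <= f t + `|C| * `|r - t|.
  move=> Ir It; rewrite -lerBlDl (le_trans (ler_norm _))//.
  by rewrite (le_trans (fC0 _ _ Ir It))// ler_wpM2r// ler_norm.
pose S t := [set f r + `|C| * `|t - r| | r in I].
have Slb t u r : S t u -> I r -> f r - `|C| * `|t - r| <= u.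
  move=> [r' Ir' <-] Ir; have := fC _ _ Ir Ir'.
  have : `|C| * `|r - r'| <= `|C| * (`|t - r| + `|t - r'|).
    rewrite ler_wpM2l// (distrC t r); have -> : r - r' = (r - t) + (t - r') by ring.
    exact: ler_normD.
  rewrite mulrDr; lra.
have infS t : has_inf (S t).
  split; first by exists (f r0 + `|C| * `|t - r0|); exists r0.
  by exists (f r0 - `|C| * `|t - r0|) => u /Slb; apply.
pose F t := inf (S t).
have FC r t : F r <= F t + `|C| * `|r - t|.
  rewrite -lerBlDr; apply: lb_le_inf; first exact: (infS t).1.
  move=> _ [r' Ir' <-]; rewrite lerBlDr.
  have Sr : S r (f r' + `|C| * `|r - r'|) by exists r'.
  apply: le_trans (ge_inf (infS r).2 Sr) _.
  rewrite -addrA lerD2l -mulrDr ler_wpM2l//.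
  have -> : r - r' = (r - t) + (t - r') by ring.
  by rewrite [leRHS]addrC ler_normD.
exists F => [r t|t It].
  by rewrite ler_norml lerBlDl lerNl opprB lerBlDl FC distrC FC.
apply/eqP; rewrite eq_le; apply/andP; split.
  apply: (ge_inf (infS t).2); exists t => //.
  by rewrite subrr normr0 mulr0 addr0.
apply: lb_le_inf; first exact: (infS t).1.
by move=> u /Slb /(_ It); rewrite subrr normr0 mulr0 subr0.
Qed.

Lemma lipschitz_extension_rV (R : realType) (N : nat) (I : set R)
    (f : R -> 'rV[R]_N) (C : R) :
  I !=set0 ->
  (forall r t, I r -> I t -> `|f r - f t| <= C * `|r - t|) ->
  exists2 F : R -> 'rV[R]_N, (forall r t, `|F r - F t| <= `|C| * `|r - t|) &
    forall t, I t -> F t = f t.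
Proof.
move=> I0 fC.
have /choice[F FP] : forall i : 'I_N, exists Fi : R -> R,
    (forall r t, `|Fi r - Fi t| <= `|C| * `|r - t|) /\
    forall t, I t -> Fi t = f t 0 i.
  move=> i; have [|Fi FiC Fif] := @lipschitz_extension _ I (fun t => f t 0 i) C I0.
    move=> r t Ir It; apply: le_trans (fC _ _ Ir It).
    by apply: le_trans (normr_coord_le _ i); rewrite !mxE.
  by exists Fi.
exists (fun t => \row_i F i t) => [r t|t It].
  apply: norm_rV_le => [|i]; first by rewrite mulr_ge0.
  by rewrite !mxE; exact: (FP i).1.
by apply/rowP => i; rewrite mxE; exact: (FP i).2.
Qed.

(** * Estimates on the bounded confidence vector field *)

Section interaction.
Context (R : realType).
Implicit Types (u D e : R).

Lemma s_cases u : (`|u| < 1 /\ s u = 1) \/ (1 <= `|u| /\ s u = 0).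
Proof. by rewrite /s; case: ltP => H; [left|right]. Qed.

Lemma s_opp u : s (- u) = s u.
Proof. by rewrite /s normrN. Qed.

Lemma normr_smul_le1 u : `|s u * u| <= 1.
Proof.
by case: (s_cases u) => -[u1 ->]; rewrite ?mul1r ?mul0r ?normr0// ltW.
Qed.

Lemma smul_le u e : 0 <= e -> u <= e -> s u * u <= e.
Proof. by case: (s_cases u) => -[_ ->]; rewrite ?mul1r ?mul0r. Qed.

Lemma smul_ge u e : 0 <= e -> - e <= u -> - e <= s u * u.
Proof. by case: (s_cases u) => -[_ ->]; rewrite ?mul1r ?mul0r// oppr_le0. Qed.

(** When both terms are active the difference is - D.  When exactly one of them
    is cut off, the other either increases the difference or has absolute value
    at most D. *)
Lemma smul_shift_ge u D : 0 <= D -> - D <= s (u - D) * (u - D) - s u * u.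
Proof.
case: (s_cases u) => -[u1 ->]; case: (s_cases (u - D)) => -[u2 ->];
  rewrite ?mul1r ?mul0r;
  move: u1 u2; rewrite ?ltr_norml ?ler_normr => /= + + D0; lra.
Qed.

End interaction.

Section bounded_confidence.
Context (R : realType) (N : nat).
Implicit Types (y : 'rV[R]_N) (e : R).
Notation g := (@bounded_confidence R N).

Let sum_const (c : R) : \sum_(k < N) c = N%:R * c.
Proof. by rewrite sumr_const card_ord mulr_natl. Qed.

Lemma bounded_confidence_coord_le y i : `|g y 0 i| <= N%:R.
Proof.
rewrite mxE; apply: le_trans (ler_norm_sum _ _ _) _.
rewrite -[leRHS]mulr1 -sum_const; apply: ler_sum => k _; exact: normr_smul_le1.
Qed.

Lemma bounded_confidence_le y i e : 0 <= e ->
  (forall k, y 0 k <= y 0 i + e) -> g y 0 i <= N%:R * e.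
Proof.
move=> e0 ye; rewrite mxE -sum_const; apply: ler_sum => k _.
by apply: smul_le => //; rewrite lerBlDl.
Qed.

Lemma bounded_confidence_ge y i e : 0 <= e ->
  (forall k, y 0 i - e <= y 0 k) -> - (N%:R * e) <= g y 0 i.
Proof.
move=> e0 ye; rewrite mxE -mulrN -sum_const; apply: ler_sum => k _.
by apply: smul_ge => //; have := ye k; lra.
Qed.

(** Term by term, with D the gap between the two agents, this is
    [smul_shift_ge]. *)
Lemma bounded_confidence_sub_ge y i j : y 0 i <= y 0 j ->
  - (N%:R * (y 0 j - y 0 i)) <= g y 0 j - g y 0 i.
Proof.
move=> yij; rewrite !mxE -sumrB -mulrN -sum_const; apply: ler_sum => k _.
have -> : y 0 k - y 0 j = (y 0 k - y 0 i) - (y 0 j - y 0 i) by ring.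
by apply: smul_shift_ge; rewrite subr_ge0.
Qed.

Lemma bounded_confidence_sum0 y : \sum_i g y 0 i = 0.
Proof.
pose a i k := s (y 0 k - y 0 i) * (y 0 k - y 0 i).
have -> : \sum_i g y 0 i = \sum_i \sum_k a i k by apply: eq_bigr => i _; rewrite mxE.
suff : \sum_i \sum_k a i k = - \sum_i \sum_k a i k by lra.
rewrite [LHS]exchange_big -sumrN/=; apply: eq_bigr => i _.
rewrite -sumrN; apply: eq_bigr => k _.
by rewrite /a -mulrN opprB -s_opp opprB.
Qed.

Lemma dot_coord (i : 'I_N) (y : 'rV[R]_N) : dot (fun k => (k == i)%:R) y = y 0 i.
Proof.
rewrite /dot (bigD1 i)//= eqxx mul1r big1 ?addr0// => k /negbTE ->.
by rewrite mul0r.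
Qed.

Lemma dot_opp (w : 'I_N -> R) (y : 'rV[R]_N) : dot (fun k => - w k) y = - dot w y.
Proof. by rewrite /dot -sumrN; apply: eq_bigr => k _; rewrite mulNr. Qed.

Lemma dot_sub (w w' : 'I_N -> R) (y : 'rV[R]_N) :
  dot (fun k => w k - w' k) y = dot w y - dot w' y.
Proof. by rewrite /dot -sumrB; apply: eq_bigr => k _; rewrite mulrBl. Qed.

End bounded_confidence.

(** * Order, contraction and average along solutions *)

Lemma convex_set_comb (R : realType) (V : lmodType R) (A : set V) (l : R)
    (u v : V) :
  @convex_set R V A -> 0 <= l -> l <= 1 -> A u -> A v ->
  A (l *: u + (1 - l) *: v).
Proof.
move=> cA l0 l1 Au Av.
by have := cA u v (Itv01 l0 l1); rewrite !inE; apply.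
Qed.

Lemma convex_set_between (R : realType) (A : set R) (a b c : R) :
  @convex_set R R^o A -> A a -> A b -> a <= c -> c <= b -> A c.
Proof.
move=> cA Aa Ab ac cb; have [ab|ba] := ltP a b; last first.
  by have <- : a = c by apply/eqP; rewrite eq_le ac (le_trans cb).
have ba0 : 0 < b - a by rewrite subr_gt0.
have bane0 : b - a != 0 by rewrite gt_eqF.
have -> : c = ((b - c) / (b - a)) *: (a : R^o) + (1 - (b - c) / (b - a)) *: (b : R^o).
  by rewrite -![_ *: _]/(_ * _); field.
apply: convex_set_comb => //.
  by rewrite divr_ge0// ?subr_ge0// ltW.
by rewrite ler_pdivrMr// mul1r lerB.
Qed.

Section krasovskii_velocities.
Context (R : realType) (N : nat).
Implicit Types (z v : 'rV[R]_N).
Notation g := (@bounded_confidence R N).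

Let N0 : 0 <= N%:R :> R. Proof. exact: ler0n. Qed.

(** Only points at distance at most half the gap are considered, so that the
    order of the two agents is the same as at [z]. *)
Lemma krasovskii_sub_ge z v i j : z 0 i < z 0 j -> krasovskii g z v ->
  - (N%:R * (z 0 j - z 0 i)) <= v 0 j - v 0 i.
Proof.
move=> zij; rewrite -(dot_coord j v) -(dot_coord i v) -dot_sub.
have gap : 0 < (z 0 j - z 0 i) / 2 by rewrite divr_gt0// subr_gt0.
have N20 : 0 <= 2 * N%:R :> R by exact: mulr_ge0.
apply: (krasovskii_dot_ge_linear N20 gap) => d y d0 dgap zy.
have := zy i; have := zy j; rewrite !ler_norml => /andP[j1 j2] /andP[i1 i2].
have yij : y 0 i <= y 0 j by lra.
rewrite dot_sub !dot_coord; apply: le_trans (bounded_confidence_sub_ge yij).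
have : N%:R * (y 0 j - y 0 i) <= N%:R * (z 0 j - z 0 i + 2 * d).
  by rewrite ler_wpM2l//; lra.
lra.
Qed.

(** At a point at distance d from [z], agent i is rightmost up to 2 d. *)
Lemma krasovskii_max_le z v i :
  (forall k, z 0 k <= z 0 i) -> krasovskii g z v -> v 0 i <= 0.
Proof.
move=> zi; rewrite -lerN2 oppr0 -(dot_coord i v) -dot_opp.
have N20 : 0 <= 2 * N%:R :> R by exact: mulr_ge0.
apply: (krasovskii_dot_ge_linear N20 ltr01) => d y d0 _ zy.
have yik k : y 0 k <= y 0 i + 2 * d.
  have := zi k; have := zy i; have := zy k.
  by rewrite !ler_norml => /andP[? ?] /andP[? ?]; lra.
have d20 : 0 <= 2 * d by lra.
rewrite dot_opp dot_coord; have := bounded_confidence_le d20 yik; lra.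
Qed.

Lemma krasovskii_min_ge z v i :
  (forall k, z 0 i <= z 0 k) -> krasovskii g z v -> 0 <= v 0 i.
Proof.
move=> zi; rewrite -(dot_coord i v).
have N20 : 0 <= 2 * N%:R :> R by exact: mulr_ge0.
apply: (krasovskii_dot_ge_linear N20 ltr01) => d y d0 _ zy.
have yik k : y 0 i - 2 * d <= y 0 k.
  have := zi k; have := zy i; have := zy k.
  by rewrite !ler_norml => /andP[? ?] /andP[? ?]; lra.
have d20 : 0 <= 2 * d by lra.
rewrite dot_coord; have := bounded_confidence_ge d20 yik; lra.
Qed.

End krasovskii_velocities.

Section solutions.
Context (R : realType) (N : nat).
Context (xbar : 'rV[R]_N) (I : set R) (x : R -> 'rV[R]_N).
Notation g := (@bounded_confidence R N).
Hypothesis xsol : krasovskii_solution g xbar I x.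

Lemma solution_coord_dist_le i r t : I r -> I t -> r <= t ->
  `|x t 0 i - x r 0 i| <= N%:R * (t - r).
Proof.
move=> Ir It rt; rewrite ler_norml; apply/andP; split.
  rewrite -mulNr -(dot_coord i (x t)) -(dot_coord i (x r)).
  apply: (krasovskii_solution_dot_ge xsol) => // u v _ _.
  apply: krasovskii_dot_ge => e e0; exists 1 => // y _.
  rewrite dot_coord; have := bounded_confidence_coord_le y i.
  by rewrite ler_norml => /andP[+ _]; lra.
have : - N%:R * (t - r) <= dot (fun k => - (k == i)%:R) (x t) -
                           dot (fun k => - (k == i)%:R) (x r).
  apply: (krasovskii_solution_dot_ge xsol) => // u v _ _.
  apply: krasovskii_dot_ge => e e0; exists 1 => // y _.
  rewrite dot_opp dot_coord; have := bounded_confidence_coord_le y i.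
  by rewrite ler_norml => /andP[_ +]; lra.
rewrite !dot_opp !dot_coord; lra.
Qed.

Lemma solution_lipschitz r t : I r -> I t -> `|x r - x t| <= N%:R * `|r - t|.
Proof.
move=> Ir It; apply: norm_rV_le => [|i]; first by rewrite mulr_ge0.
rewrite !mxE; have [rt|/ltW tr] := leP r t.
  rewrite distrC (distrC r) (ger0_norm (_ : 0 <= t - r)) ?subr_ge0//.
  exact: solution_coord_dist_le.
rewrite (ger0_norm (_ : 0 <= r - t)) ?subr_ge0//.
exact: solution_coord_dist_le.
Qed.

Lemma solution_average r t : I r -> I t -> r <= t ->
  \sum_i x t 0 i = \sum_i x r 0 i.
Proof.
move=> Ir It rt.
have dotE (c : R) u : dot (fun=> c) u = c * \sum_(i < N) u 0 i.
  by rewrite /dot mulr_sumr.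
have H (c : R) : 0 * (t - r) <= dot (fun=> c) (x t) - dot (fun=> c) (x r).
  apply: (krasovskii_solution_dot_ge xsol) => // u v _ _.
  apply: krasovskii_dot_ge => e e0; exists 1 => // y _.
  by rewrite dotE bounded_confidence_sum0 mulr0 subr_le0 ltW.
have := H 1; have := H (-1); rewrite !dotE; lra.
Qed.

(** If the gap D became nonpositive, let c be the first time when it is, and let
    m maximise D on a segment [a, c] of length at most 1 / (2 N + 1).  There
    D' >= - N D >= - N D(m), so D(c) >= D(m) - N (c - m) D(m) > 0. *)
Lemma solution_order i j t1 t2 : I t1 -> I t2 -> t1 <= t2 ->
  x t1 0 i < x t1 0 j -> x t2 0 i < x t2 0 j.
Proof.
move=> It1 It2 t12 xij1.
have I0 : I !=set0 by exists t1.
have [X XC Xx] := lipschitz_extension_rV I0 solution_lipschitz.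
(* The extension makes the gap continuous on the whole line. *)
pose D t := X t 0 j - X t 0 i.
have DC : continuous D.
  apply: (@lipschitz_continuous _ R (`|N%:R| + `|N%:R|)) => r t.
  have -> : D r - D t = (X r - X t) 0 j - (X r - X t) 0 i.
    by rewrite !mxE /D; ring.
  apply: le_trans (ler_normB _ _) _; rewrite mulrDl.
  by apply: lerD; exact: le_trans (normr_coord_le _ _) (XC _ _).
have D1 : 0 < D t1 by rewrite /D Xx// subr_gt0.
suff : 0 < D t2 by rewrite /D Xx// subr_gt0.
rewrite ltNge; apply/negP => D2.
pose S := [set t | [/\ t1 <= t, t <= t2 & D t <= 0]].
have S2 : S t2 by [].
have lbS : has_lbound S by exists t1 => t [].
have infS : has_inf S by split => //; exists t2.
pose c := inf S.
have t1c : t1 <= c by apply: lb_le_inf => [|t []//]; exists t2.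
have ct2 : c <= t2 by exact: ge_inf.
have Dpos t : t1 <= t -> t < c -> 0 < D t.
  move=> t1t tc; rewrite ltNge; apply/negP => Dt.
  have : S t by split => //; rewrite (le_trans (ltW tc)).
  by move=> /(ge_inf lbS); rewrite leNgt tc.
have Dc : D c <= 0.
  rewrite leNgt; apply/negP => Dc.
  have /(@cvgrPdist_lt _ R)/(_ _ Dc)[d /= d0 dH] := DC c.
  have [t [t1t tt2 Dt] tcd] := inf_adherent d0 infS.
  have ct : c <= t by apply: (ge_inf lbS).
  have : 0 < D t.
    have /= := dH t; rewrite distrC ger0_norm ?subr_ge0// ltrBlDl => /(_ tcd).
    by rewrite ltr_norml => /andP[_]; lra.
  by rewrite ltNge Dt.
have t1ltc : t1 < c.
  by rewrite lt_neqAle t1c andbT; apply/eqP => t1E; move: D1; rewrite t1E ltNge Dc.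
have N0 : 0 <= N%:R :> R by [].
have NN0 : 0 < 2 * N%:R + 1 :> R by lra.
pose a := Num.max t1 (c - (2 * N%:R + 1)^-1).
have t1a : t1 <= a by rewrite le_max lexx.
have ac : a < c by rewrite gt_max t1ltc/= ltrBlDr ltrDl invr_gt0.
have [] := @EVT_max R D a c (ltW ac); first exact: continuous_subspaceT.
move=> m; rewrite in_itv/= => /andP[am mc] mmax.
have Dm : 0 < D m.
  apply: (@lt_le_trans _ _ (D a)); first exact: Dpos.
  by apply: mmax; rewrite in_itv/= lexx ltW.
have [itvI _] := xsol; have {itvI} itvI : is_interval I by case: itvI.
have Iin t : t1 <= t -> t <= t2 -> I t.
  by move=> t1t tt2; apply: (itvI _ _ It1 It2); rewrite t1t.
have Im : I m by apply: Iin; [exact: le_trans am|exact: le_trans ct2].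
have Ic : I c by exact: Iin.
have DE t : I t -> D t = dot (fun k => (k == j)%:R - (k == i)%:R) (x t).
  by move=> It; rewrite dot_sub !dot_coord /D Xx.
have key : - (N%:R * D m) * (c - m) <= D c - D m.
  rewrite [D c]DE// [X in _ <= _ - X]DE//.
  apply: (krasovskii_solution_dot_ge xsol) => // t v mt tc Kv.
  rewrite dot_sub !dot_coord.
  have t1t : t1 <= t by rewrite (le_trans t1a)// (le_trans am)// ltW.
  have It : I t by apply: Iin => //; rewrite (le_trans (ltW tc)).
  have Dt := Dpos t t1t tc; move: (Dt); rewrite /D Xx// subr_gt0 => xijt.
  apply: le_trans (krasovskii_sub_ge xijt Kv); rewrite lerN2 ler_wpM2l//.
  have := mmax t; rewrite in_itv/= (ltW tc) (le_trans am (ltW mt)) => /(_ isT).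
  by rewrite /D !Xx.
have cm : (c - m) * (2 * N%:R + 1) <= 1.
  rewrite -ler_pdivlMr// mul1r; have : c - (2 * N%:R + 1)^-1 <= m.
    by apply: le_trans am; rewrite le_max lexx orbT.
  lra.
have : D m * ((c - m) * (2 * N%:R + 1)) <= D m by rewrite ger_pMr.
have : 0 <= D m * (c - m).
  by apply: mulr_ge0; [exact: ltW|rewrite subr_ge0].
nra.
Qed.

(** An agent rightmost at [t2] is rightmost on the whole of [t1, t2], for if it
    were behind another agent at some time it would still be at [t2]. *)
Lemma solution_max_le i t1 t2 : I t1 -> I t2 -> t1 <= t2 ->
  (forall k, x t2 0 k <= x t2 0 i) -> x t2 0 i <= x t1 0 i.
Proof.
move=> It1 It2 t12 imax.
have [[itvI _ _ _] _] := xsol.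
have : 0 * (t2 - t1) <= dot (fun k => - (k == i)%:R) (x t2) -
                        dot (fun k => - (k == i)%:R) (x t1).
  apply: (krasovskii_solution_dot_ge xsol) => // t v t1t tt2 Kv.
  rewrite dot_opp dot_coord oppr_ge0; apply: krasovskii_max_le Kv => k.
  rewrite leNgt; apply/negP => ik; have := imax k; rewrite leNgt => /negP; apply.
  apply: (solution_order _ It2 (ltW tt2) ik).
  by apply: (itvI _ _ It1 It2); rewrite !ltW.
rewrite !dot_opp !dot_coord; lra.
Qed.

Lemma solution_min_ge i t1 t2 : I t1 -> I t2 -> t1 <= t2 ->
  (forall k, x t2 0 i <= x t2 0 k) -> x t1 0 i <= x t2 0 i.
Proof.
move=> It1 It2 t12 imin.
have [[itvI _ _ _] _] := xsol.
rewrite -(dot_coord i (x t1)) -(dot_coord i (x t2)) -subr_ge0 -[leLHS](mul0r (t2 - t1)).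
apply: (krasovskii_solution_dot_ge xsol) => // t v t1t tt2 Kv.
rewrite dot_coord; apply: krasovskii_min_ge Kv => k.
rewrite leNgt; apply/negP => ik; have := imin k; rewrite leNgt => /negP; apply.
apply: (solution_order _ It2 (ltW tt2) ik).
by apply: (itvI _ _ It1 It2); rewrite !ltW.
Qed.

Lemma solution_contractive t1 t2 : I t1 -> I t2 -> t1 <= t2 ->
  closed_convex_hull (range (fun i : 'I_N => x t2 0 i)) `<=`
  closed_convex_hull (range (fun i : 'I_N => x t1 0 i)).
Proof.
move=> It1 It2 t12 u hu C [[clC cvC] rC]; apply: hu; split=> // _ [k _ <-].
have [i _ imax] := @Order.TotalTheory.arg_maxP _ _ _ k xpredT (fun i => x t2 0 i) isT.
have [j _ jmin] := @Order.TotalTheory.arg_minP _ _ _ k xpredT (fun i => x t2 0 i) isT.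
have Cr l : C (x t1 0 l) by apply: rC; exists l.
apply: (convex_set_between cvC (Cr j) (Cr i)).
  by apply: le_trans (jmin k isT); apply: solution_min_ge => // l; exact: jmin.
apply: le_trans (imax k isT) _.
by apply: solution_max_le => // l; exact: imax.
Qed.

End solutions.

(** * Existence by Euler approximation *)

Lemma ultrafilter_bounded_cvg (R : realType) (N : nat) (T : Type)
    (U : set_system T) (f : T -> 'rV[R]_N) (B : R) :
  UltraFilter U -> (forall n, `|f n| <= B) -> exists p : 'rV[R]_N, f n @[n --> U] --> p.
Proof.
move=> UU fB.
have : compact [set u : 'rV[R]_N | `|u| <= B].
  apply: bounded_closed_compact.
    by exists B; split; [exact: num_real|move=> M BM u /= /le_trans; apply; exact: ltW].
  rewrite -[X in closed X]/((@Num.norm _ 'rV[R]_N) @^-1` [set r | r <= B]).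
  by apply: closed_comp => [u _|]; [exact: norm_continuous|exact: closed_le].
move=> /(_ (f n @[n --> U]) (fmap_proper_filter _ _)) cA.
have [|p [_ clp]] := cA.
  by apply: (@filterE _ U) => n; exact: fB.
exists p => A pA.
have [//|UA] := in_ultra_setVsetC (f @^-1` A) UU.
have [q []] := clp (~` A) A UA pA.
by [].
Qed.

Lemma convex_set_average (R : realType) (V : lmodType R) (A : set V) (n : nat)
    (u : nat -> V) : @convex_set R V A -> (forall i, (i <= n)%N -> A (u i)) ->
  A (n.+1%:R^-1 *: \sum_(i < n.+1) u i).
Proof.
move=> cA; elim: n => [|n IH] Au.
  by rewrite big_ord1 invr1 scale1r; exact: Au.
rewrite big_ord_recr/= scalerDr.
have n1 : n.+1%:R != 0 :> R by rewrite pnatr_eq0.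
have n2 : n.+2%:R != 0 :> R by rewrite pnatr_eq0.
have n2E : n.+2%:R = n.+1%:R + 1 :> R by rewrite -[in LHS]addn1 natrD.
pose l : R := n.+1%:R / n.+2%:R.
have -> : n.+2%:R^-1 *: \sum_(i < n.+1) u i =
    l *: (n.+1%:R^-1 *: \sum_(i < n.+1) u i).
  by rewrite scalerA; congr (_ *: _); rewrite /l mulrAC divff// mul1r.
have -> : n.+2%:R^-1 = 1 - l.
  by rewrite /l -[X in X - _](divff n2) -mulrBl n2E addrAC subrr add0r mul1r.
apply: convex_set_comb => //.
- by rewrite /l divr_ge0.
- by rewrite /l ler_pdivrMr ?ltr0Sn// mul1r ler_nat.
- by apply: IH => i ilen; apply: Au; exact: leqW.
- exact: Au.
Qed.

Section euler.
Context (R : realType) (N : nat) (g : 'rV[R]_N -> 'rV[R]_N) (C : R).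
Hypothesis gC : forall y, `|g y| <= C.
Variables (T : R) (z : 'rV[R]_N).

Definition euler_step (n k : nat) : 'rV[R]_N :=
  iter k (fun y => y + n.+1%:R^-1 *: g y) z.

(** [Num.truncn] is 0 on negative numbers, so that [euler] below is constantly
    the initial point before time T. *)
Definition euler_index (n : nat) (t : R) : nat :=
  Num.truncn ((t - T) * n.+1%:R).

Definition euler (n : nat) (t : R) : 'rV[R]_N := euler_step n (euler_index n t).

Let C0 : 0 <= C. Proof. exact: le_trans (gC 0). Qed.

Let n0 n : 0 < n.+1%:R :> R. Proof. by rewrite ltr0Sn. Qed.

Lemma euler_stepD n k l : euler_step n (k + l) =
  euler_step n k + n.+1%:R^-1 *: \sum_(i < l) g (euler_step n (k + i)).
Proof.
elim: l => [|l IH]; first by rewrite big_ord0 scaler0 addr0 addn0.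
by rewrite big_ord_recr/= scalerDr addrA -IH addnS.
Qed.

Lemma euler_step_dist n k l :
  `|euler_step n (k + l) - euler_step n k| <= C * (l%:R / n.+1%:R).
Proof.
rewrite euler_stepD addrC addKr normrZ ger0_norm ?invr_ge0// mulrA mulrC.
rewrite ler_wpM2r ?invr_ge0//; apply: le_trans (ler_norm_sum _ _ _) _.
by rewrite mulr_natr -[X in _ *+ X]card_ord -sumr_const; exact: ler_sum.
Qed.

Lemma euler_index_le n r t : r <= t -> (euler_index n r <= euler_index n t)%N.
Proof. by move=> rt; apply: le_truncn; rewrite ler_wpM2r// lerB. Qed.

Lemma euler_index_init n t : t <= T -> euler_index n t = 0%N.
Proof.
move=> tT; apply/eqP; rewrite -leqn0 truncn_le_nat.
by apply: le_lt_trans (ltr01); rewrite mulr_le0_ge0// subr_le0.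
Qed.

Lemma euler_index_sub_le n r t : r <= t ->
  (euler_index n t - euler_index n r)%:R / n.+1%:R <= t - r + n.+1%:R^-1.
Proof.
move=> rt; rewrite ler_pdivrMr// mulrDl mulVf ?gt_eqF//.
have [tT|/ltW Tt] := leP t T.
  by rewrite euler_index_init// sub0n addr_ge0// mulr_ge0// subr_ge0.
rewrite natrB; last exact: euler_index_le.
have : (euler_index n t)%:R <= (t - T) * n.+1%:R.
  by rewrite truncn_le mulr_ge0// subr_ge0.
have := truncnS_gt ((r - T) * n.+1%:R); rewrite -[X in _ < X]natr1 -/(euler_index n r).
lra.
Qed.

Lemma euler_index_sub_ge n r t : T <= r -> r <= t ->
  t - r - n.+1%:R^-1 <= (euler_index n t - euler_index n r)%:R / n.+1%:R.
Proof.
move=> Tr rt; rewrite ler_pdivlMr// mulrBl mulVf ?gt_eqF//.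
rewrite natrB; last exact: euler_index_le.
have : (euler_index n r)%:R <= (r - T) * n.+1%:R.
  by rewrite truncn_le mulr_ge0// subr_ge0.
have := truncnS_gt ((t - T) * n.+1%:R); rewrite -[X in _ < X]natr1 -/(euler_index n t).
lra.
Qed.

Lemma euler_dist_le n r t : r <= t ->
  `|euler n t - euler n r| <= C * (t - r + n.+1%:R^-1).
Proof.
move=> rt; rewrite /euler -(subnKC (euler_index_le n rt)).
apply: le_trans (euler_step_dist _ _ _) _.
by rewrite ler_wpM2l// euler_index_sub_le.
Qed.

Lemma euler_init n t : t <= T -> euler n t = z.
Proof. by move=> tT; rewrite /euler euler_index_init. Qed.

(** The limit is taken pointwise along a filter finer than the usual one on
    nat; an ultrafilter makes it exist without extracting a subsequence. *)
Variables (U : set_system nat) (x : R -> 'rV[R]_N).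
Hypothesis PU : ProperFilter U.
Hypothesis UN : \oo `<=` U.
Hypothesis xlim : forall t, euler n t @[n --> U] --> x t.

Lemma near_euler t (e : R) : 0 < e -> \forall n \near U, `|x t - euler n t| <= e.
Proof. by move=> e0; have /(@cvgrPdist_le _ 'rV[R]_N) := @xlim t; apply. Qed.

Lemma near_step (e : R) : 0 < e -> \forall n \near U, n.+1%:R^-1 <= e.
Proof.
move=> e0; apply: UN; have /(@cvgrPdist_le _ R)/(_ e e0) := @cvg_harmonic R.
by apply: filterS => n /=; rewrite sub0r normrN /harmonic/= ger0_norm ?invr_ge0.
Qed.

Lemma euler_limit_lipschitz r t : `|x r - x t| <= C * `|r - t|.
Proof.
wlog rt : r t / r <= t => [H|].
  by have [/H//|/ltW/H] := leP r t; rewrite distrC (distrC t).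
rewrite distrC (distrC r) (ger0_norm (_ : 0 <= t - r)) ?subr_ge0//.
apply/ler_addgt0Pr => e e0.
have [d d0 ->] : exists2 d : R, 0 < d & e = (C + 2) * d.
  have C2 : 0 < C + 2 by rewrite ltr_wpDl.
  by exists (e / (C + 2)); [exact: divr_gt0|rewrite mulrCA divff ?mulr1// gt_eqF].
suff [n [xr xt hn]] : exists n, [/\ `|x r - euler n r| <= d,
    `|x t - euler n t| <= d & n.+1%:R^-1 <= d].
  have -> : x t - x r = (x t - euler n t) + (euler n t - euler n r) - (x r - euler n r).
    by rewrite opprB addrA subrKA subrK.
  apply: le_trans (ler_normB _ _) _; rewrite -lerBrDr.
  apply: le_trans (ler_normD _ _) _; rewrite -lerBrDl.
  apply: le_trans (euler_dist_le _ rt) _.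
  apply: (@le_trans _ _ (C * (t - r + d))); first by rewrite ler_wpM2l// lerD2l.
  lra.
by have [n [? [? ?]]] := filter_ex (filterI (near_euler r d0)
  (filterI (near_euler t d0) (near_step d0))); exists n.
Qed.

Lemma euler_limit_init t : t <= T -> x t = z.
Proof.
move=> tT; apply/eqP; rewrite -subr_eq0 -normr_le0; apply/ler_addgt0Pr => e e0.
rewrite add0r; have [n] := filter_ex (near_euler t e0).
by rewrite euler_init.
Qed.

(** For n large in U, (x(t + q) - x(t)) / q is close to the average a of the
    values of g at the Euler points visited between t and t + q.  These points
    are close to x(t), so a belongs to any closed convex A containing g on a
    ball around x(t), and so does the limit v. *)
Lemma euler_limit_krasovskii t v : T <= t -> is_derive t (1 : R) x v ->
  krasovskii g (x t) v.
Proof.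
move=> Tt dv d /= d0 A [[clA cvA] gA]; apply: clA => B.
move=> /(@nbhs_ballP R 'rV[R]_N)[e /= e0 eB].
suff [a Aa va] : exists2 a, A a & `|v - a| < e.
  by exists a; split => //; apply: eB; rewrite -ball_normE.
have [e1 e10 eE] : exists2 e1 : R, 0 < e1 & e = 5 * e1.
  by exists (e / 5); [exact: divr_gt0|rewrite mulrCA divff ?mulr1].
have [η η0 xη] := is_derive_near dv e10.
have C1 : 0 < C + 1 by rewrite ltr_wpDl.
(* The Euler points visited up to t + q stay within C (q + h) of the one at t,
   where h is the step; the bound on q keeps them in the ball of radius d. *)
have [q [q0 qη Cq]] : exists q : R, [/\ 0 < q, q < η & 2 * (C * q) <= d / 2].
  exists (Num.min (η / 2) (d / 4 / (C + 1))); split.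
  - by rewrite lt_min !divr_gt0.
  - by rewrite gt_min ltr_pdivrMr// ltr_pMr// ltr1n.
  - set q := Num.min _ _; have : q * (C + 1) <= d / 4.
      by rewrite -ler_pdivlMr// ge_min lexx orbT.
    have : 0 <= q by rewrite le_min !divr_ge0// ltW.
    lra.
have e1q : 0 < e1 * q by exact: mulr_gt0.
have [e2 [e20 e2q e2d]] : exists e2 : R, [/\ 0 < e2, e2 <= e1 * q & e2 < d / 2].
  exists (Num.min (e1 * q) (d / 4)); split.
  - by rewrite lt_min e1q divr_gt0.
  - by rewrite ge_min lexx.
  - by rewrite gt_min; apply/orP; right; lra.
have [h0 [h00 h0q Ch0]] : exists h0 : R, [/\ 0 < h0, h0 < q & C * h0 <= e1 * q].
  exists (Num.min (q / 2) (e1 * q / (C + 1))); split.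
  - by rewrite lt_min !divr_gt0.
  - by rewrite gt_min ltr_pdivrMr// ltr_pMr// ltr1n.
  - set h := Num.min _ _; have : h * (C + 1) <= e1 * q.
      by rewrite -ler_pdivlMr// ge_min lexx orbT.
    have : 0 <= h by rewrite le_min !divr_ge0// ltW.
    lra.
pose r := t + q.
have rtq : r - t = q by rewrite /r addrAC subrr add0r.
have tr : t <= r by rewrite lerDl ltW.
have [n [xr [xt nh]]] := filter_ex (filterI (near_euler r e20)
  (filterI (near_euler t e20) (near_step h00))).
(* L is the time actually elapsed between the two Euler points, within one
   step of q. *)
pose k := euler_index n t; pose l := (euler_index n r - k)%N.
pose L : R := l%:R / n.+1%:R.
have Lq : L <= q + h0.
  apply: le_trans (euler_index_sub_le n tr) _.
  by rewrite rtq lerD2l.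
have qL : q - h0 <= L.
  apply: le_trans (euler_index_sub_ge n Tt tr).
  by rewrite rtq lerD2l lerN2.
have l0 : (0 < l)%N.
  rewrite lt0n; apply/eqP => l0; have : L = 0 by rewrite /L l0 mul0r.
  lra.
have rE : euler_index n r = (k + l)%N by rewrite subnKC// euler_index_le.
pose a := l%:R^-1 *: \sum_(i < l) g (euler_step n (k + i)).
have lne0 : l%:R != 0 :> R by rewrite pnatr_eq0 -lt0n.
have eulerE : euler n r = euler n t + L *: a.
  rewrite /euler rE euler_stepD /a scalerA; congr (_ + _ *: _).
  by rewrite /L mulrAC divff// mul1r.
have Aa : A a.
  rewrite /a -(prednK l0).
  apply: (convex_set_average (u := fun i => g (euler_step n (k + i)))) => // i il.
  apply: gA; exists (euler_step n (k + i)) => //=.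
  have -> : x t - euler_step n (k + i) =
      (x t - euler n t) - (euler_step n (k + i) - euler_step n k).
    by rewrite opprB addrA subrK.
  apply: le_lt_trans (ler_normB _ _) _.
  have : C * (i%:R / n.+1%:R) <= C * (q + q).
    rewrite ler_wpM2l//; apply: (@le_trans _ _ L); last first.
      by apply: le_trans Lq _; rewrite lerD2l ltW.
    by rewrite ler_wpM2r ?invr_ge0// ler_nat (leq_trans il)// leq_pred.
  have := euler_step_dist n k i.
  move: (`|euler_step n (k + i) - _|) (C * (i%:R / _)) xt => u w; lra.
have aC : `|a| <= C.
  rewrite /a normrZ ger0_norm ?invr_ge0// mulrC ler_pdivrMr ?ltr0n//.
  apply: le_trans (ler_norm_sum _ _ _) _.
  by rewrite mulr_natr -[X in _ *+ X]card_ord -sumr_const; exact: ler_sum.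
exists a => //; rewrite -(ltr_pM2l q0) -[X in X * `|_|](gtr0_norm q0) -normrZ.
have -> : q *: (v - a) = (x r - euler n r) - (x t - euler n t)
    - (x r - x t - q *: v) + (L - q) *: a.
  rewrite eulerE; move: (x r) (x t) (euler n t) v a {B dv eB xη Aa aC eulerE xr xt}.
  by move=> xr xt u v a; apply/rowP => i; rewrite !mxE; ring.
have : `|x r - x t - q *: v| <= e1 * q.
  by have := xη r; rewrite rtq (gtr0_norm q0); apply.
have : `|(L - q) *: a| <= e1 * q.
  rewrite normrZ; apply: le_trans Ch0; rewrite mulrC; apply: ler_pM => //.
  by rewrite ler_norml; apply/andP; split; lra.
move=> H1 H2.
apply: le_lt_trans (ler_normD _ _) _; rewrite -ltrBrDr.
apply: le_lt_trans (ler_normB _ _) _; rewrite -ltrBrDr.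
apply: le_lt_trans (ler_normB _ _) _.
rewrite eE; lra.
Qed.

End euler.

(** The limit of the Euler approximations is Lipschitz, so its derivative exists
    almost everywhere, and it is a Krasovskii velocity wherever it exists. *)
Lemma krasovskii_forward_solution (R : realType) (N : nat)
    (g : 'rV[R]_N -> 'rV[R]_N) (C : R) (T : R) (z : 'rV[R]_N) :
  (forall y, `|g y| <= C) ->
  exists x : R -> 'rV[R]_N,
    [/\ x T = z, forall r t, `|x r - x t| <= C * `|r - t| &
      {ae @lebesgue_measure R, forall t, T <= t ->
        exists2 v, krasovskii g (x t) v & is_derive t 1 x v}].
Proof.
move=> gC.
have [U [UU UN]] := ultraFilterLemma (@eventually_filter).
have /choice[x xlim] : forall t, exists p : 'rV[R]_N, euler g T z n t @[n --> U] --> p.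
  move=> t; have [tT|/ltW Tt] := leP t T.
    exists z; under eq_cvg do rewrite euler_init//.
    exact: cvg_cst.
  apply: (@ultrafilter_bounded_cvg _ _ _ _ _ (`|z| + C * (t - T + 1))) => n.
  have zE : z = euler g T z n T by rewrite euler_init.
  rewrite -[euler g T z n t](subrK z) addrC.
  apply: le_trans (ler_normD _ _) _; rewrite lerD2l {2}zE.
  apply: le_trans (euler_dist_le gC _ _ n Tt) _.
  rewrite ler_wpM2l ?(le_trans _ (gC 0))// lerD2l invf_le1 ?ltr0Sn//.
  by rewrite ler1n.
have PU : ProperFilter U by exact: ultra_proper.
have xC := euler_limit_lipschitz gC PU UN xlim.
exists x; split => //.
  exact: (euler_limit_init PU xlim).
have aecoord (i : 'I_N) : {ae @lebesgue_measure R, forall t,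
    derivable (fun t => x t 0 i) t 1}.
  apply: (@lipschitz_ae_derivable _ C) => r t.
  by apply: le_trans (xC r t); apply: le_trans (normr_coord_le _ i); rewrite !mxE.
have aeall : {ae @lebesgue_measure R, forall t,
    forall i : 'I_N, derivable (fun t => x t 0 i) t 1}.
  by apply: filter_forall => i; exact: aecoord.
move: aeall; apply: filterS; first exact: (ae_filter_ringOfSetsType lebesgue_measure).
move=> t dx Tt.
have {}dx : derivable x t 1.
  by apply/derivable_mxP => i j; rewrite (ord1 i); exact: dx.
exists ('D_1 x t); last exact: DeriveDef.
by apply: (euler_limit_krasovskii gC PU UN xlim) => //; exact: DeriveDef.
Qed.

(** * Completeness and the theorem *)

Lemma bounded_confidence_norm_le (R : realType) (N : nat) (y : 'rV[R]_N) :
  `|bounded_confidence y| <= N%:R.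
Proof. by apply: norm_rV_le => // i; exact: bounded_confidence_coord_le. Qed.

Lemma ae_neq (R : realType) (c : R) : {ae @lebesgue_measure R, forall t, t != c}.
Proof.
exists [set c]; split; [exact: measurable_set1|exact: lebesgue_measure_set1|].
by move=> t /= /negP; rewrite negbK => /eqP.
Qed.

(** The extension X of x gives the value at T = sup I, whether or not T belongs
    to I, and the solution is continued from X(T). *)
Lemma krasovskii_solution_complete (R : realType) (N : nat)
    (g : 'rV[R]_N -> 'rV[R]_N) (C : R) (xbar : 'rV[R]_N) (I : set R)
    (x : R -> 'rV[R]_N) :
  (forall y, `|g y| <= C) ->
  (forall r t, I r -> I t -> `|x r - x t| <= C * `|r - t|) ->
  krasovskii_solution g xbar I x ->
  exists2 y : R -> 'rV[R]_N, krasovskii_solution g xbar `[0, +oo[ y &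
    forall t, I t -> y t = x t.
Proof.
move=> gC xC xsol; have [[itvI I0oo I0 x0] [acx aex]] := xsol.
have Ige0 t : I t -> 0 <= t by move=> /I0oo; rewrite /= in_itv/= andbT.
have [ubI|nubI] := pselect (has_ubound I); last first.
  exists x => //; suff -> : `[0, +oo[%classic = I by [].
  apply/seteqP; split=> // t; rewrite /= in_itv/= andbT => t0.
  have [r Ir tr] : exists2 r, I r & t <= r.
    apply: contrapT => H; apply: nubI; exists t => r Ir.
    by rewrite leNgt; apply/negP => tr; apply: H; exists r => //; exact: ltW.
  by apply: (itvI _ _ I0 Ir); rewrite t0.
have In0 : I !=set0 by exists 0.
have [X XC Xx] := lipschitz_extension_rV In0 xC.
have C0 : 0 <= C by exact: le_trans (gC 0).
pose T := sup I.
have T0 : 0 <= T by exact: ub_le_sup.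
have [w [wT wC aew]] := krasovskii_forward_solution T (X T) gC.
pose y t := if t <= T then X t else w t.
have yX t : t <= T -> y t = X t by rewrite /y => ->.
have yw t : T <= t -> y t = w t.
  move=> Tt; rewrite /y; case: ifPn => // tT.
  by have -> : t = T by apply/eqP; rewrite eq_le tT.
have yC r t : `|y r - y t| <= C * `|r - t|.
  wlog rt : r t / r <= t => [H|].
    by have [/H//|/ltW/H] := leP r t; rewrite distrC (distrC t).
  have {}XC r' t' : `|X r' - X t'| <= C * `|r' - t'|.
    by rewrite -[C]ger0_norm.
  have [tT|/ltW Tt] := leP t T; first by rewrite !yX// (le_trans rt).
  have [rT|/ltW Tr] := leP r T; last by rewrite !yw// (le_trans Tr).
  rewrite yX// yw//.
  have -> : X r - w t = (X r - X T) + (w T - w t) by rewrite wT addrA subrK.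
  apply: le_trans (ler_normD _ _) _.
  apply: (@le_trans _ _ (C * `|r - T| + C * `|T - t|)); first exact: lerD.
  by rewrite -mulrDr ler_wpM2l// !ler0_norm ?subr_le0//; lra.
exists y; last by move=> t It; rewrite yX ?Xx//; exact: ub_le_sup.
split; first split.
- move=> r t; rewrite /= !in_itv/= !andbT => r0 t0 u /andP[ru _].
  by rewrite in_itv/= andbT (le_trans r0).
- by [].
- by rewrite /= in_itv/= lexx.
- by rewrite yX// Xx.
split.
  by move=> a b _ _; apply: (@lipschitz_abs_continuous _ _ _ _ C) => r t _ _.
have aef : Filter (almost_everywhere (@lebesgue_measure R)).
  exact: ae_filter_ringOfSetsType.
have aeall : {ae @lebesgue_measure R, forall t,
    ((I t -> exists2 v, krasovskii g (x t) v & is_derive t 1 x v) /\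
     (T <= t -> exists2 v, krasovskii g (w t) v & is_derive t 1 w v)) /\
    (t != 0 /\ t != T)}.
  by apply: (@filterI _ _ aef); apply: (@filterI _ _ aef) => //; exact: ae_neq.
move: aeall; apply: (@filterS _ _ aef).
move=> t [[xt wt] [t0 tT]]; rewrite /= in_itv/= andbT => tge0.
(* At 0 and T the derivative of y need not be that of x or w, as y agrees with
   them on one side only. *)
have {}t0 : 0 < t by rewrite lt_neqAle eq_sym t0.
have [tltT|Tltt|tE] := ltgtP t T; last by move: tT; rewrite tE eqxx.
- have Iin r : 0 < r -> r < T -> I r.
    move=> r0 rT; have Tr : 0 < T - r by rewrite subr_gt0.
    have [u Iu ru] := sup_adherent Tr (conj In0 ubI).
    by apply: (itvI _ _ I0 Iu); rewrite (ltW r0)/=; rewrite subKr in ru; exact: ltW.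
  have [v Kv dv] := xt (Iin _ t0 tltT).
  have yx : \forall r \near t, x r = y r.
    near=> r; have Ir : I r.
      by apply: Iin; near: r; [apply: lt_nbhsr|apply: lt_nbhsl].
    by rewrite yX ?Xx//; exact: ub_le_sup.
  exists v; last exact: near_eq_is_derive dv.
  by rewrite -(nbhs_singleton yx).
- have [v Kv dv] := wt (ltW Tltt).
  have yw' : \forall r \near t, w r = y r.
    by near=> r; rewrite yw//; apply: ltW; near: r; exact: lt_nbhsr.
  exists v; last exact: near_eq_is_derive dv.
  by rewrite yw// ltW.
Unshelve. all: by end_near. Qed.

Theorem proposition1 (R : realType) (N : nat) (N_ge1 : (1 <= N)%N) :
  (forall xbar : 'rV[R]_N,
    exists2 eps : R, 0 < eps &
      exists x : R -> 'rV[R]_N,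
        krasovskii_solution (@bounded_confidence R N) xbar `[0, eps[ x) /\
  (forall (xbar : 'rV[R]_N) (I : set R) (x : R -> 'rV[R]_N),
    krasovskii_solution (@bounded_confidence R N) xbar I x ->
    [/\ forall (i j : 'I_N) (t1 t2 : R), I t1 -> I t2 ->
          x t1 0 i < x t1 0 j -> t1 < t2 -> x t2 0 i < x t2 0 j,
        forall t1 t2 : R, I t1 -> I t2 -> t1 < t2 ->
          closed_convex_hull (range (fun i : 'I_N => x t2 0 i)) `<=`
          closed_convex_hull (range (fun i : 'I_N => x t1 0 i)),
        exists2 y : R -> 'rV[R]_N,
          krasovskii_solution (@bounded_confidence R N) xbar `[0, +oo[ y &
          {in I, y =1 x} &
        forall t : R, I t -> 0 < t -> x_ave x t = x_ave x 0]).
Proof.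
split=> [xbar|xbar I x xsol].
  exists 1 => //.
  have [x [x0 xC aex]] := krasovskii_forward_solution 0 xbar
    (@bounded_confidence_norm_le R N).
  exists x; split; first split.
  - exact: interval_is_interval.
  - by move=> t /=; rewrite !in_itv/= => /andP[-> _].
  - by rewrite /= in_itv/= lexx ltr01.
  - exact: x0.
  split.
    by move=> a b _ _; apply: (@lipschitz_abs_continuous _ _ _ _ N%:R) => r t _ _.
  apply: (@filterS _ _ (ae_filter_ringOfSetsType lebesgue_measure)) aex => t xt.
  by rewrite /= in_itv/= => /andP[/xt].
have [[_ _ I0 _] _] := xsol.
split.
- move=> i j t1 t2 It1 It2 xij t12.
  by apply: (solution_order xsol It1) xij => //; exact: ltW.
- by move=> t1 t2 It1 It2 /ltW t12; exact: (solution_contractive xsol).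
- have [y ysol yx] := krasovskii_solution_complete
    (@bounded_confidence_norm_le R N) (solution_lipschitz xsol) xsol.
  by exists y => // t; rewrite inE; exact: yx.
- by move=> t It /ltW t0; rewrite /x_ave (solution_average xsol I0 It t0).
Qed.
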